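(* Let $p \geq 5$ be a prime and assume that $-1,3\in \mathcal{S}(p)$ and $2\in \mathcal{T}(p)$. Then any graph can be decomposed into $K_1$, $K_2$, $K_3$, $B$ and $X_6$ over $\mathbb{F}_p$, where $X_6:=K_6$ if $5\in \mathcal{T}(p)$, $X_6:=D$ if $7\in \mathcal{T}(p)$, and $X_6$ is not required otherwise. That is: if $5\in\mathcal{T}(p)$, any graph can be decomposed into $K_1,K_2,K_3,B,K_6$ over $\mathbb{F}_p$; if $7\in\mathcal{T}(p)$, any graph can be decomposed into $K_1,K_2,K_3,B,D$ over $\mathbb{F}_p$; and if $5\notin\mathcal{T}(p)$ and $7\notin\mathcal{T}(p)$, any graph can be decomposed into $K_1,K_2,K_3,B$ over $\mathbb{F}_p$.
   Context: Graphs are finite, undirected and simple. A graph $X$ is identified with its adjacency matrix (entry $1$ at $(u,v)$ if $uv$ is an edge, $0$ otherwise), regarded as a matrix over the field under consideration. For a prime $p$, $\mathbb{F}_p$ is the field with $p$ elements, $\mathbb{F}_p^\times=\mathbb{F}_p\setminus\{0\}$, $\mathcal{S}(p)=\{a^2 : a\in\mathbb{F}_p^\times\}$ and $\mathcal{T}(p)=\mathbb{F}_p^\times\setminus\mathcal{S}(p)$; integers are regarded as elements of $\mathbb{F}_p$ by reduction mod $p$. For square matrices, $M\oplus M'$ denotes the block diagonal matrix with blocks $M,M'$, and $nM$ denotes the direct sum $M\oplus\cdots\oplus M$ of $n$ copies of $M$. Symmetric matrices $M,M'$ over a field $k$ are called similar over $k$, written $M\sim M'$, if there is an invertible matrix $P$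 over $k$ with $M'=P^tMP$ (i.e. they are congruent). A graph $X$ can be decomposed into graphs $X_1,\dots,X_s$ over $k$ if $X\sim n_1X_1\oplus\cdots\oplus n_sX_s$ over $k$ for some integers $n_i\geq 0$. $K_n$ is the complete graph on $n$ vertices. $B$ is the graph on $5$ vertices consisting of two triangles sharing exactly one vertex (vertices $o,a,b,c,d$; edges $oa,ob,oc,od,ab,cd$). $D$ is the graph on $6$ vertices $a,b,c,d,e,f$ with the $11$ edges $ab,bc,cd,da,bd,ea,eb,ed,fb,fc,fd$ (two copies of $K_4$ sharing exactly the edge $bd$). *)

(* Defs.v *)
From mathcomp Require Import all_boot all_order all_algebra.

Set Implicit Arguments.
Unset Strict Implicit.
Unset Printing Implicit Defensive.

Import GRing.Theory.
Local Open Scope ring_scope.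

Record sgraph := SGraph {
  vert :> finType;
  adj : rel vert;
  adj_sym : symmetric adj;
  adj_irr : irreflexive adj }.

(* Vertices are listed in the order of [enum]; another order only conjugates
   the matrix by a permutation matrix. *)
Definition adjmx (F : fieldType) (X : sgraph) : 'M[F]_#|X| :=
  \matrix_(i, j) (adj (enum_val i) (enum_val j))%:R.

(* "Similar" in the sense of congruence, M' = P^t M P.  The two sizes are only
   provably equal in general, hence the cast. *)
Definition mxsimilar (F : fieldType) (m n : nat) (M : 'M[F]_m) (M' : 'M[F]_n) :
    Prop :=
  exists (eq_mn : m = n) (P : 'M[F]_n),
    P \in unitmx /\ M' = P^T *m castmx (eq_mn, eq_mn) M *m P.

Definition mxcopies (F : fieldType) (m n : nat) (M : 'M[F]_m) :
    'M[F]_(\sum_(_ < n) m) :=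
  \mxdiag_(_ < n) M.

Section GraphOfEdges.
Variables (n : nat) (E : seq (nat * nat)).

Definition edges_adj : rel 'I_n := [rel u v : 'I_n |
  (u != v) && (((val u, val v) \in E) || ((val v, val u) \in E))].

Fact edges_adj_sym : symmetric edges_adj.
Proof. by move=> u v; rewrite /edges_adj /= eq_sym orbC. Qed.

Fact edges_adj_irr : irreflexive edges_adj.
Proof. by move=> u; rewrite /edges_adj /= eqxx. Qed.

Definition graph_of_edges : sgraph := SGraph edges_adj_sym edges_adj_irr.
End GraphOfEdges.

Definition complete_adj (n : nat) : rel 'I_n := [rel u v : 'I_n | u != v].

Fact complete_adj_sym n : symmetric (@complete_adj n).
Proof. by move=> u v; rewrite /complete_adj /= eq_sym. Qed.

Fact complete_adj_irr n : irreflexive (@complete_adj n).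
Proof. by move=> u; rewrite /complete_adj /= eqxx. Qed.

Definition K (n : nat) : sgraph :=
  SGraph (@complete_adj_sym n) (@complete_adj_irr n).

Definition decomposes (F : fieldType) (X : sgraph) (Xs : seq sgraph) : Prop :=
  exists n : 'I_(size Xs) -> nat,
    mxsimilar (adjmx F X)
      (\mxdiag_(i < size Xs) mxcopies (n i) (adjmx F (nth (K 0) Xs i))).

(* o, a, b, c, d = 0, 1, 2, 3, 4 *)
Definition B : sgraph := graph_of_edges 5
  [:: (0, 1); (0, 2); (0, 3); (0, 4); (1, 2); (3, 4)]%N.

(* a, b, c, d, e, f = 0, 1, 2, 3, 4, 5; edges ab bc cd da bd ea eb ed fb fc fd *)
Definition D : sgraph := graph_of_edges 6
  [:: (0, 1); (1, 2); (2, 3); (3, 0); (1, 3);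
      (4, 0); (4, 1); (4, 3); (5, 1); (5, 2); (5, 3)]%N.

Definition Fsquares (p : nat) : {set 'F_p} :=
  [set a ^+ 2 | a : 'F_p & a != 0].

Definition Fnonsquares (p : nat) : {set 'F_p} :=
  [set x : 'F_p | x != 0] :\: Fsquares p.

(* Main.v *)
Require Import Defs.
From Stdlib Require Import ZArith.
From mathcomp Require Import all_boot all_order all_fingroup all_algebra.
From mathcomp Require Import ring zify.
From mathcomp.zify Require Import ssrZ.

(** Over F_p, symmetric matrices are classified up to congruence by their size,
    rank r and discriminant modulo squares.  The adjacency matrix of a graph of
    rank r is congruent to the direct sum of a zero block and a nonsingular
    principal submatrix of size r, so its discriminant is the determinant of a
    graph on r vertices.  Under the hypotheses on p, the graphs K_2 and B have
    square discriminant and ranks 2 and 5, while K_3 and X_6 have nonsquare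
    discriminant and ranks 3 and 6.  Their multiples, padded with copies of
    K_1, realise every pair (rank, discriminant) except rank 1, rank 3 with
    square discriminant, and rank 2 or 4 (and 6, in the absence of X_6) with
    nonsquare discriminant.  These exceptions do not come from graphs, because
    the determinants of graphs on 1, 2, 3, 4 and 6 vertices lie in {0},
    {0, -1}, {0, 2}, {0, 1, -3} and {0, -1, 3, 4, -4, -5, 7}. *)

Set Implicit Arguments.
Unset Strict Implicit.
Unset Printing Implicit Defensive.

Import GRing.Theory.
Local Open Scope ring_scope.

(** * Congruence and diagonal forms *)

Section Congruence.
Variable F : fieldType.

Lemma mxsimilarP n (A B : 'M[F]_n) :
  mxsimilar A B <-> exists2 P, P \in unitmx & B = P^T *m A *m P.
Proof.
split=> [[e [P [uP ->]]]|[P uP ->]]; first by exists P => //; rewrite castmx_id.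
by exists erefl, P.
Qed.

Lemma mxsimilar_refl n (A : 'M[F]_n) : mxsimilar A A.
Proof.
by apply/mxsimilarP; exists 1%:M; rewrite ?unitmx1 // trmx1 mul1mx mulmx1.
Qed.

Lemma mxsimilar_cast n m (e1 e2 : n = m) (A : 'M[F]_n) :
  mxsimilar A (castmx (e1, e2) A).
Proof. by case: m / e1 e2 => e2; rewrite castmx_id; apply: mxsimilar_refl. Qed.

Lemma mxsimilar_sym n m (A : 'M[F]_n) (B : 'M[F]_m) :
  mxsimilar A B -> mxsimilar B A.
Proof.
case=> e; case: m / e B => B [P [uP ->]]; rewrite castmx_id.
apply/mxsimilarP; exists (invmx P); first by rewrite unitmx_inv.
by rewrite trmx_inv !mulmxA mulVmx ?unitmx_tr // mul1mx mulmxK.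
Qed.

Lemma mxsimilar_trans n m k (A : 'M[F]_n) (B : 'M[F]_m) (C : 'M[F]_k) :
  mxsimilar A B -> mxsimilar B C -> mxsimilar A C.
Proof.
case=> e; case: m / e B => B [P [uP ->]]; rewrite castmx_id.
case=> e; case: k / e C => C [Q [uQ ->]]; rewrite castmx_id.
apply/mxsimilarP; exists (P *m Q); first by rewrite unitmx_mul uP.
by rewrite trmx_mul !mulmxA.
Qed.

Lemma mxsimilar_block n1 n2 m1 m2 (A : 'M[F]_n1) (B : 'M[F]_n2)
    (A' : 'M[F]_m1) (B' : 'M[F]_m2) :
  mxsimilar A A' -> mxsimilar B B' ->
  mxsimilar (block_mx A 0 0 B) (block_mx A' 0 0 B').
Proof.
case=> e; case: m1 / e A' => A' [P [uP ->]]; rewrite castmx_id.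
case=> e; case: m2 / e B' => B' [Q [uQ ->]]; rewrite castmx_id.
apply/mxsimilarP; exists (block_mx P 0 0 Q).
  by rewrite unitmxE det_ublock unitrM -!unitmxE uP.
by rewrite tr_block_mx !mulmx_block !trmx0 !(mul0mx, mulmx0, addr0, add0r).
Qed.

(** Diagonal forms are indexed by sequences, so that direct sums become concatenations and
    reordering the entries becomes [perm_eq]. *)
Definition dgmx (s : seq F) : 'M[F]_(size s) := diag_mx (\row_j s`_j).

Lemma det_dgmx s : \det (dgmx s) = \prod_(x <- s) x.
Proof.
by rewrite det_diag (big_nth 0) big_mkord; apply: eq_bigr => i; rewrite mxE.
Qed.

Lemma dgmx_unit s : (dgmx s \in unitmx) = all (predC1 0) s.
Proof. by rewrite unitmxE det_dgmx unitfE prodf_seq_neq0. Qed.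

Definition lsim (s t : seq F) := mxsimilar (dgmx s) (dgmx t).

Lemma dgmx_cat s t : mxsimilar (dgmx (s ++ t)) (block_mx (dgmx s) 0 0 (dgmx t)).
Proof.
have -> : block_mx (dgmx s) 0 0 (dgmx t) =
    castmx (size_cat s t, size_cat s t) (dgmx (s ++ t)).
  apply/matrixP=> i j; rewrite castmxE.
  case: (split_ordP i) => i' ->; case: (split_ordP j) => j' ->;
    rewrite ?block_mxEul ?block_mxEur ?block_mxEdl ?block_mxEdr !mxE;
    rewrite nth_cat -!(inj_eq val_inj) /= ?ltn_ord ?eqn_add2l //.
  - by rewrite ltn_eqF // (leq_trans (ltn_ord i')) ?leq_addr.
  - by rewrite gtn_eqF // (leq_trans (ltn_ord j')) ?leq_addr.
  - by rewrite ltnNge leq_addr /= addKn.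
exact: mxsimilar_cast.
Qed.

Lemma mxsimilar_dgmx0 n : mxsimilar (0 : 'M[F]_n) (dgmx (nseq n 0)).
Proof.
apply: mxsimilar_sym; have e := size_nseq n (0 : F).
have -> : 0 = castmx (e, e) (dgmx (nseq n 0)).
  by apply/matrixP=> i j; rewrite castmxE !mxE nth_nseq if_same mul0rn.
exact: mxsimilar_cast.
Qed.

Lemma lsim_refl s : lsim s s. Proof. exact: mxsimilar_refl. Qed.
Lemma lsim_sym s t : lsim s t -> lsim t s. Proof. exact: mxsimilar_sym. Qed.
Lemma lsim_trans t s u : lsim s t -> lsim t u -> lsim s u.
Proof. exact: mxsimilar_trans. Qed.

Lemma lsim_cat s1 s2 t1 t2 :
  lsim s1 t1 -> lsim s2 t2 -> lsim (s1 ++ s2) (t1 ++ t2).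
Proof.
move=> h1 h2; apply: mxsimilar_trans (dgmx_cat _ _) _.
apply: mxsimilar_trans (mxsimilar_sym (dgmx_cat _ _)); exact: mxsimilar_block.
Qed.

Lemma lsim_perm s t : perm_eq s t -> lsim s t.
Proof.
move=> st; have e := perm_size st.
have /tuple_permP[p def_s] : perm_eq s (in_tuple t) by [].
apply/mxsimilar_sym; exists (esym e).
have -> : castmx (esym e, esym e) (dgmx t) = diag_mx (\row_j t`_j).
  by apply/matrixP=> i j; rewrite castmxE !mxE.
(* [q] is the permutation [p] of the indices of [t], carried over to those of [s]. *)
pose q := cast_perm (esym e) p; exists (perm_mx q)^T.
rewrite unitmx_tr unitmx_perm trmxK -row_permE tr_perm_mx -col_permE.
split=> //.
apply/matrixP=> i j; rewrite !mxE (inj_eq perm_inj); congr (_ *+ _).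
have i_lt : (i < size t)%N by rewrite -e.
rewrite {1}def_s (nth_map (Ordinal i_lt)) ?size_enum_ord // (tnth_nth 0) /=.
rewrite /q cast_permE; congr t`_(p _); apply: val_inj.
by rewrite /= nth_enum_ord.
Qed.

(** Completes a nonzero vector to a basis: by rank decomposition [v] is a nonzero scalar times the
    first row of an invertible matrix, and the scalar is absorbed into that matrix. *)
Lemma unitmx_with_row n (v : 'rV[F]_n.+1) :
  v != 0 -> exists2 P, P \in unitmx & row 0 P = v.
Proof.
move=> v0; have := mulmx_ebase v; rewrite rank_rV v0 => <-.
have uL := col_ebase_unit v; set L := col_ebase v in uL *.
have eL : L = (L 0 0)%:M by apply/matrixP=> i j; rewrite !ord1 mxE eqxx.
have L0 : L 0 0 != 0 by move: uL; rewrite {1}eL unitmxE det_scalar1 unitfE.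
exists (L 0 0 *: row_ebase v).
  by rewrite unitmxZ ?unitfE // row_ebase_unit.
rewrite [X in X *m _ *m _]eL mul_scalar_mx -scalemxAl.
rewrite [LHS]linearZ /= rowE; congr (_ *: (_ *m _)).
by apply/matrixP=> i j; rewrite !mxE !ord1 /= andbT -(inj_eq val_inj) eq_sym.
Qed.

(** Block Gaussian elimination done simultaneously on rows and columns; the lower right block
    becomes the Schur complement of [a]. *)
Lemma mxsimilar_schur n1 n2 (a : 'M[F]_n1) (c : 'M[F]_(n1, n2)) (E : 'M[F]_n2) :
  a \in unitmx -> a^T = a ->
  mxsimilar (block_mx a c c^T E) (block_mx a 0 0 (E - c^T *m invmx a *m c)).
Proof.
move=> ua sa; apply/mxsimilarP; exists (block_mx 1%:M (- invmx a *m c) 0 1%:M).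
  by rewrite unitmxE det_ublock !det1 mulr1 unitr1.
rewrite tr_block_mx !mulmx_block !trmx0 !trmx1.
rewrite !(mul0mx, mulmx0, addr0, add0r, mul1mx, mulmx1) mulNmx mulmxN.
rewrite mulKVmx // addNr.
rewrite linearN /= trmx_mul trmx_inv sa mulmxN mulNmx mulmxKV // addNr.
by rewrite mul0mx oppr0 add0r mulNmx addrC.
Qed.

(** A nonzero diagonal entry gives a basis vector. If the diagonal vanishes and [A i j] does not,
    the form takes the value [2 * A i j] at the sum of the basis vectors [i] and [j]. *)
Lemma sym_anisotropic n (A : 'M[F]_n) : 2%:R != 0 :> F -> A^T = A -> A != 0 ->
  exists v : 'rV_n, (v *m A *m v^T) 0 0 != 0.
Proof.
move=> two0 sA A0; have E i j :
    (delta_mx (0 : 'I_1) i *m A *m (delta_mx 0 j)^T) 0 (0 : 'I_1) = A i j.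
  by rewrite trmx_delta -rowE -colE !mxE.
have [i Aii|diag0] := pickP (fun i => A i i != 0).
  by exists (delta_mx 0 i); rewrite E.
have [[i j] /= Aij|all0] := pickP (fun ij => A ij.1 ij.2 != 0); last first.
  case/eqP: A0; apply/matrixP=> i j; rewrite mxE; apply/eqP.
  by have /negbFE := all0 (i, j).
exists (delta_mx 0 i + delta_mx 0 j).
have addE (X Y : 'M[F]_1) : (X + Y) 0 0 = X 0 0 + Y 0 0 by rewrite mxE.
rewrite linearD /= !(mulmxDl, mulmxDr) !addE !E.
have diag k : A k k = 0 by apply/eqP/negbFE/diag0.
have -> : A j i = A i j by rewrite -[in LHS]sA mxE.
by rewrite !diag add0r addr0 -mulr2n -mulr_natl mulf_neq0.
Qed.

(** An anisotropic vector is made the first basis vector, its orthogonal complement is split off by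
    [mxsimilar_schur], and induction applies to the complement. *)
Lemma sym_diagonalizable n (A : 'M[F]_n) : 2%:R != 0 :> F -> A^T = A ->
  exists s, mxsimilar A (dgmx s).
Proof.
move=> two0; elim: n A => [|n IHn] A sA.
  exists [::]; rewrite (flatmx0 A) -(flatmx0 (dgmx [::])).
  exact: mxsimilar_refl.
have [->|A0] := eqVneq A 0.
  by exists (nseq n.+1 0); apply: mxsimilar_dgmx0.
have [v vA] := sym_anisotropic two0 sA A0.
have v0 : v != 0 by apply: contraNneq vA => ->; rewrite !mul0mx mxE.
have [P uP def_v] := unitmx_with_row v0.
pose A' : 'M_(1 + n) := P *m A *m P^T.
have AA' : mxsimilar A A'.
  by apply/mxsimilarP; exists P^T; rewrite ?unitmx_tr // trmxK.
have sA' : A'^T = A' by rewrite /A' !trmx_mul trmxK sA mulmxA.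
have A'00 : A' 0 0 != 0.
  (* The corner entry is the value of the form at the first row of [P], which is [v]. *)
  have -> // : A' 0 0 = (v *m A *m v^T) 0 0.
  rewrite -def_v -row_mul tr_row [LHS]mxE [RHS]mxE.
  by apply: eq_bigr => k _; rewrite [X in _ = X * _]mxE [X in _ = _ * X]mxE.
pose a := ulsubmx A'; pose c := ursubmx A'.
have def_A' : A' = block_mx a c c^T (drsubmx A').
  by rewrite /c trmx_ursub sA' submxK.
have a00 : a 0 0 = A' 0 0.
  by rewrite [LHS]mxE [LHS]mxE; congr (A' _ _); apply: val_inj.
have ua : a \in unitmx.
  by rewrite unitmxE (mx11_scalar a) det_scalar1 unitfE a00.
have sa : a^T = a by rewrite trmx_ulsub sA'.
have [|s Es] := IHn (drsubmx A' - c^T *m invmx a *m c).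
  by rewrite linearB /= trmx_drsub sA' !trmx_mul trmxK trmx_inv sa mulmxA.
exists ([:: A' 0 0] ++ s); apply: mxsimilar_trans AA' _.
have := mxsimilar_schur c (drsubmx A') ua sa; rewrite -def_A'.
move/mxsimilar_trans; apply.
apply: mxsimilar_trans (mxsimilar_sym (dgmx_cat _ _)).
apply: mxsimilar_block => //.
suff -> : a = dgmx [:: a 0 0] by rewrite a00; apply: mxsimilar_refl.
by apply/matrixP=> i j; rewrite (ord1 i) (ord1 j) [RHS]mxE [X in _ = X *+ _]mxE.
Qed.

(** Full row rank gives [Y = L [1 0] R] with [L] and [R] invertible; [R] removes the change of basis
    and [L] only alters [M] by a congruence. *)
Lemma mxsimilar_row_free n r k (Y : 'M[F]_(r, n)) (M : 'M[F]_r) :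
  n = (r + k)%N -> row_free Y ->
  mxsimilar (Y^T *m M *m Y) (block_mx M 0 0 (0 : 'M_k)).
Proof.
move/esym=> def_n; case: n / def_n Y => Y /eqP rY; apply: mxsimilar_sym.
pose L := col_ebase Y; pose R := row_ebase Y.
have defY : Y = L *m row_mx 1%:M 0 *m R.
  by rewrite -[LHS]mulmx_ebase rY pid_mx_row.
apply: (@mxsimilar_trans _ _ _ _ (block_mx (L^T *m M *m L) 0 0 (0 : 'M_k))).
  apply: mxsimilar_block (mxsimilar_refl _).
  by apply/mxsimilarP; exists L => //; apply: col_ebase_unit.
apply/mxsimilarP; exists R; first exact: row_ebase_unit.
rewrite [in LHS]defY !trmx_mul tr_row_mx trmx1 trmx0 !mulmxA.
congr (_ *m _); rewrite -!mulmxA; congr (_ *m _).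
rewrite !(mul_mx_row, mulmx1, mulmx0) mul_col_mx mul1mx mul0mx.
by rewrite block_mxEh col_mx0.
Qed.

(* The rows of a symmetric matrix indexed by a basis of its row space cut out,
   together with the same columns, a nonsingular matrix. *)
Lemma sym_principal_submx n (A : 'M[F]_n) : A^T = A ->
  exists r (f : 'I_r -> 'I_n), mxsub f f A \in unitmx /\
    mxsimilar A (block_mx (mxsub f f A) 0 0 (0 : 'M_(n - r))).
Proof.
move=> sA; have [r [f [rkA]]] : exists r (f : 'I_r -> 'I_n),
    \rank A = r /\ (A <= rowsub f A)%MS.
  by exists (\rank A), (maxrankfun A); rewrite eq_maxrowsub.
case/submxP=> Z defA; exists r, f; set M := mxsub f f A.
(* Transpose [A = Z *m rowsub f A], use the symmetry of [A], and keep the rows selected by [f]. *)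
have rowA : rowsub f A = M *m Z^T.
  rewrite -[in LHS]sA [in LHS]defA trmx_mul -mul_rowsub_mx; congr (_ *m _).
  by apply/matrixP=> i j; rewrite /M -[in RHS]sA !mxE.
have defA' : A = Z *m M *m Z^T by rewrite -mulmxA -rowA.
(* Since [A = Z *m M *m Z^T] has rank [r], each factor has rank at least [r], hence full rank. *)
have rZ : row_free Z^T.
  rewrite /row_free eqn_leq rank_leq_row /=.
  by apply: leq_trans (mxrankM_maxr (Z *m M) _); rewrite -defA' rkA.
have uM : M \in unitmx.
  rewrite -row_free_unit /row_free eqn_leq rank_leq_row /=.
  apply: leq_trans (mxrankM_maxr Z M).
  by apply: leq_trans (mxrankM_maxl _ Z^T); rewrite -defA' rkA.
have le_rn : (r <= n)%N by rewrite -rkA rank_leq_row.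
split=> //; have := mxsimilar_row_free M (esym (subnKC le_rn)) rZ.
by rewrite trmxK -defA'.
Qed.

Lemma mxsimilar_det n (A B : 'M[F]_n) : mxsimilar A B ->
  exists2 x, x != 0 & \det B = \det A * x ^+ 2.
Proof.
case/mxsimilarP=> P uP ->; exists (\det P); first by rewrite -unitfE -unitmxE.
by rewrite !det_mulmx det_tr mulrC mulrA mulrC expr2.
Qed.

Lemma sym_unitmx_diagonalizable n (A : 'M[F]_n) :
  2%:R != 0 :> F -> A^T = A -> A \in unitmx ->
  exists s, [/\ size s = n, all (predC1 0) s, mxsimilar A (dgmx s) &
    exists2 x, x != 0 & \prod_(y <- s) y = \det A * x ^+ 2].
Proof.
move=> two0 sA uA; have [s As] := sym_diagonalizable two0 sA.
have e : size s = n by case: As => e _.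
exists s; case: n / e A As sA uA => A As _ uA; split=> //.
  case/mxsimilarP: As uA => P uP def_s.
  by rewrite -dgmx_unit def_s !unitmx_mul unitmx_tr uP => ->.
by rewrite -det_dgmx; apply: mxsimilar_det.
Qed.

End Congruence.

(** * Determinants of small graphs *)

Definition delete_nth (T : Type) j (s : seq T) := take j s ++ drop j.+1 s.

Fixpoint altsum (s : seq Z) : Z := if s is x :: s' then x - altsum s' else 0.

(** Expansion along the first row, shaped for evaluation: entries are bits, arithmetic is binary in
    [Z], and minors at zero entries are skipped. *)
Fixpoint laplace n (A : seq bitseq) : Z :=
  if n is m.+1 then
    altsum [seq if nth false (head [::] A) j
                then laplace m [seq delete_nth j r | r <- behead A] else 0
           | j <- iota 0 n]
  else 1.

(** [bump j] underlies [lift j], so deleting entry [j] of each row matches the column removed in a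
    cofactor. *)
Lemma nth_delete_nth T (x : T) j s k :
  nth x (delete_nth j s) k = nth x s (bump j k).
Proof.
rewrite /delete_nth /bump nth_cat size_take.
have [le_sj|lt_js] := leqP (size s) j.
  rewrite take_oversize // drop_oversize ?leqW // nth_nil.
  case: ltnP => [/leq_trans/(_ le_sj)|le_sk].
    by rewrite ltnNge => /negbTE->.
  by rewrite nth_default // (leq_trans le_sk) ?leq_addl.
case: ltnP => [lt_kj|le_jk]; first by rewrite nth_take.
by rewrite nth_drop add1n addSn subnKC.
Qed.

Lemma altsumE s : altsum s = \sum_(j < size s) (-1) ^+ j * s`_j.
Proof.
elim: s => [|x s IHs]; first by rewrite big_ord0.
rewrite -[altsum _]/(x - altsum s) IHs big_ord_recl expr0 mul1r -sumrN.
by congr (_ + _); apply: eq_bigr => j _; rewrite lift0 exprS mulN1r mulNr.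
Qed.

Lemma det_laplaceZ n (A : seq bitseq) :
  \det (\matrix_(i < n, j < n) (nth false (nth [::] A i) j)%:R) = laplace n A.
Proof.
elim: n A => [|n IHn] A; first by rewrite det_mx00.
rewrite (expand_det_row _ ord0) [RHS]altsumE size_map size_iota.
apply: eq_bigr => j _; rewrite (nth_map 0%N) ?size_iota // nth_iota // add0n.
rewrite mxE nth0 mulrC -mulrA mulrC; case: ifP => _; last first.
  by rewrite mulr0 mul0r mulr0.
rewrite mulr1 /cofactor add0n mulrC; congr (_ * _).
rewrite -[RHS]/(laplace n _) -IHn; congr (\det _).
apply/matrixP=> i k; rewrite !mxE /= -nth_behead; congr (_%:R).
(* Rows past the end of [A] are empty and read as zero on both sides. *)
have [lt_i|le_i] := ltnP i (size (behead A)).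
  by rewrite (nth_map [::]) // nth_delete_nth.
by rewrite !(nth_default [::]) ?size_map // !nth_nil.
Qed.

Lemma det_laplace (R : comNzRingType) n (A : seq bitseq) :
  \det (\matrix_(i < n, j < n) (nth false (nth [::] A i) j)%:R : 'M[R]_n)
    = (int_of_Z (laplace n A))%:~R.
Proof.
rewrite -det_laplaceZ -(det_map_mx int_of_Z) -(det_map_mx intr).
by congr (\det _); apply/matrixP=> i j; rewrite !mxE !rmorph_nat.
Qed.

Fixpoint bitseqs n : seq bitseq :=
  if n is m.+1 then [seq b :: s | b <- [:: true; false], s <- bitseqs m]
  else [:: [::]].

(** All labelled graphs, built one vertex at a time: the neighbourhood [s] of the new vertex is the
    rest of its row and, through [zip], of its column. *)
Fixpoint graph_matrices n : seq (seq bitseq) :=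
  if n is m.+1 then
    [seq (false :: s) :: [seq p.1 :: p.2 | p <- zip s A]
    | s <- bitseqs m, A <- graph_matrices m]
  else [:: [::]].

Lemma mem_bitseqs s : s \in bitseqs (size s).
Proof.
elim: s => // b s IHs; apply: allpairs_f IHs.
by case: b.
Qed.

Definition relmx (T : Type) (e : rel T) (s : seq T) : seq bitseq :=
  [seq [seq e x y | y <- s] | x <- s].

Lemma relmx_graph_matrices T (e : rel T) s : symmetric e -> irreflexive e ->
  relmx e s \in graph_matrices (size s).
Proof.
move=> e_sym e_irr; elim: s => // x s IHs.
rewrite /relmx /= e_irr.
have -> : [seq e y x :: [seq e y z | z <- s] | y <- s] =
    [seq p.1 :: p.2 | p <- zip [seq e x y | y <- s] (relmx e s)].
  by rewrite zip_map -map_comp; apply: eq_map => y /=; rewrite e_sym.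
apply: (allpairs_f (fun t A =>
  (false :: t) :: [seq p.1 :: p.2 | p <- zip t A])) => //.
by rewrite -(size_map (e x) s) mem_bitseqs.
Qed.

Lemma det_relmx (R : comNzRingType) (T : Type) (x0 : T) (e : rel T) n
    (s : seq T) :
  size s = n ->
  \det (\matrix_(i < n, j < n) (e (nth x0 s i) (nth x0 s j))%:R : 'M[R]_n)
    = (int_of_Z (laplace n (relmx e s)))%:~R.
Proof.
move=> sz_s; rewrite -det_laplace; congr (\det _).
apply/matrixP=> i j; rewrite !mxE.
by rewrite (nth_map x0) ?(nth_map x0) ?sz_s.
Qed.

(** Transfers one exhaustive integer computation to every ring [R], as determinants commute with the
    map from the integers. *)
Lemma det_graph (R : comNzRingType) n (S : seq int) (e : rel 'I_n) :
  all (fun A => int_of_Z (laplace n A) \in S) (graph_matrices n) ->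
  symmetric e -> irreflexive e ->
  \det (\matrix_(i, j) (e i j)%:R : 'M[R]_n) \in [seq z%:~R | z <- S].
Proof.
case: n e => [|n] e allS e_sym e_irr.
  (* The empty graph, of determinant 1, is treated apart: it has no vertex to serve as the default
     of [nth]. *)
  by rewrite det_mx00; apply/mapP; exists 1 => //; move: allS; rewrite /= andbT.
have sz : size (enum 'I_n.+1) = n.+1 by rewrite size_enum_ord.
have := det_relmx R ord0 e sz.
set M := \matrix_(i, j) _; have -> : M = \matrix_(i, j) (e i j)%:R.
  by apply/matrixP=> i j; rewrite !mxE !nth_ord_enum.
move=> ->; apply: map_f; apply: (allP allS).
by rewrite -[X in graph_matrices X]sz relmx_graph_matrices.
Qed.

(** * Classification over a finite field *)

Section Squares.
Variable F : finFieldType.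

Definition nzsq : {set F} := [set a ^+ 2 | a : F & a != 0].

Lemma nzsqP a : reflect (exists2 x, x != 0 & a = x ^+ 2) (a \in nzsq).
Proof.
by apply: (iffP imsetP) => -[x]; rewrite ?inE => x0 ->; exists x; rewrite ?inE.
Qed.

Lemma nzsq_sqr x : x != 0 -> x ^+ 2 \in nzsq.
Proof. by move=> x0; apply/nzsqP; exists x. Qed.

Lemma nzsq_neq0 a : a \in nzsq -> a != 0.
Proof. by case/nzsqP=> x x0 ->; rewrite expf_neq0. Qed.

Lemma nzsqM_neq0 a b : a * b \in nzsq -> b != 0.
Proof. by move/nzsq_neq0; apply: contraNneq => ->; rewrite mulr0. Qed.

Lemma nzsq1 : 1 \in nzsq.
Proof. by rewrite -(expr1n F 2) nzsq_sqr ?oner_neq0. Qed.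

Lemma nzsqM a b : a \in nzsq -> b \in nzsq -> a * b \in nzsq.
Proof.
case/nzsqP=> x x0 -> /nzsqP[y y0 ->]; rewrite -exprMn.
by rewrite nzsq_sqr ?mulf_neq0.
Qed.

Lemma nzsqMl a b : a \in nzsq -> (a * b \in nzsq) = (b \in nzsq).
Proof.
move=> sa; apply/idP/idP=> [|/(nzsqM sa)//]; case/nzsqP: sa => x x0 ->.
case/nzsqP=> y y0 e.
apply/nzsqP; exists (y / x); first by rewrite mulf_neq0 ?invr_eq0.
by rewrite exprMn -e exprVn mulrAC mulfV ?mul1r ?expf_neq0.
Qed.

(* A choice of square roots g covers F* by the images of g and - g. *)
Lemma card_nzsq : (#|[set~ 0%R : F]| <= #|nzsq| + #|nzsq|)%N.
Proof.
pose g a : F := odflt 0 [pick x | x ^+ 2 == a].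
have sub : [set~ 0%R : F] \subset g @: nzsq :|: (fun a => - g a) @: nzsq.
  apply/subsetP=> x; rewrite !inE => x0.
  have : g (x ^+ 2) ^+ 2 == x ^+ 2.
    by rewrite /g; case: pickP => [//|/(_ x)]; rewrite eqxx.
  rewrite eqf_sqr => /orP[]/eqP e; apply/orP; [left | right].
    by apply/imsetP; exists (x ^+ 2); rewrite ?nzsq_sqr.
  by apply/imsetP; exists (x ^+ 2); rewrite ?nzsq_sqr // e opprK.
apply: leq_trans (subset_leq_card sub) _.
apply: leq_trans (leq_card_setU _ _) _.
by rewrite leq_add ?leq_imset_card.
Qed.

(** Multiplication by [a] injects the squares into the nonsquares, which are no more numerous by
    [card_nzsq]. Hence [b = a * x] with [x] a square, and [a * b = a ^+ 2 * x]. *)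
Lemma nonsquareM a b :
  a != 0 -> a \notin nzsq -> b != 0 -> b \notin nzsq -> a * b \in nzsq.
Proof.
move=> a0 nsa b0 nsb; pose T := [set~ 0%R : F] :\: nzsq.
have subF : nzsq \subset [set~ 0%R : F].
  by apply/subsetP=> x /nzsq_neq0; rewrite !inE.
have leTS : (#|T| <= #|nzsq|)%N.
  by rewrite cardsD (setIidPr subF) leq_subLR card_nzsq.
have sub : [set a * x | x in nzsq] \subset T.
  apply/subsetP=> _ /imsetP[x sx ->]; rewrite !inE mulrC (nzsqMl _ sx) nsa.
  by rewrite mulf_neq0 // nzsq_neq0.
have /eqP eT : [set a * x | x in nzsq] == T.
  by rewrite eqEcard sub card_imset //; apply: mulfI.
have: b \in T by rewrite !inE nsb.
by rewrite -eT => /imsetP[x sx ->]; rewrite mulrA nzsqM // -expr2 nzsq_sqr.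
Qed.

(* Pigeonhole: the sets {a x^2} and {1 - b y^2} have more than #|F| elements
   in total. *)
Lemma binary_form_represents_1 (a b : F) :
  a != 0 -> b != 0 -> exists x y, a * x ^+ 2 + b * y ^+ 2 = 1.
Proof.
move=> a0 b0; pose Q := 0 |: nzsq.
(* Zero is counted twice on the right and once on the left; [card_nzsq] handles the nonzero
   elements. *)
have cardQ : (#|F| < #|Q| + #|Q|)%N.
  have e0 : 0 \notin nzsq by apply/negP=> /nzsq_neq0; rewrite eqxx.
  rewrite cardsU1 e0 -(cardsC [set 0 : F]) cards1.
  by rewrite addnACA -addnA ltn_add2l add1n ltnS card_nzsq.
have sqrQ z : z \in Q -> exists x, z = x ^+ 2.
  by case/setU1P=> [->|/nzsqP[x _ ->]]; [exists 0; rewrite expr0n | exists x].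
pose A := [set a * z | z in Q]; pose C := [set 1 - b * z | z in Q].
have cardA : #|A| = #|Q| by rewrite card_imset //; apply: mulfI.
have cardC : #|C| = #|Q|.
  by rewrite card_imset // => u v /addrI/oppr_inj; apply: mulfI.
have : A :&: C != set0.
  apply: contraTneq cardQ => disj.
  rewrite -leqNgt -[X in (X + _)%N]cardA -[X in (_ + X)%N]cardC.
  by rewrite -cardsUI disj cards0 addn0 max_card.
case/set0Pn=> w /setIP[/imsetP[_ /sqrQ[x ->] ->] /imsetP[_ /sqrQ[y ->] e]].
by exists x, y; rewrite e subrK.
Qed.
End Squares.

(** * Rank and discriminant as congruence invariants *)

Section Classification.
Variable F : finFieldType.
Hypothesis two0 : 2%:R != 0 :> F.

(** The new basis is a vector [(x, y)] of value 1 and its orthogonal [(- b y, a x)], whose value is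
    [a b (a x^2 + b y^2) = a b]. *)
Lemma lsim2 (a b : F) : a != 0 -> b != 0 -> lsim [:: a; b] [:: 1; a * b].
Proof.
move=> a0 b0; have [x [y xy1]] := binary_form_represents_1 a0 b0.
pose P : 'M[F]_2 := \matrix_(i, j)
  if i == 0 then (if j == 0 then x else - (b * y))
  else (if j == 0 then y else a * x).
have PE : dgmx [:: 1; a * b] = P^T *m dgmx [:: a; b] *m P.
  apply/matrixP=> i j; rewrite mxE !(mxE, big_ord_recl, big_ord0) /=.
  case: i j => [[|[|//]] i] [[|[|//]] j] /=; rewrite ?mulr0n ?mulr1n.
  - by rewrite -xy1; ring.
  - by ring.
  - by ring.
  - by rewrite -[LHS]mulr1 -xy1; ring.
(* Invertibility of [P] is read off from that of the product. *)
have : dgmx [:: 1; a * b] \in unitmx.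
  by rewrite dgmx_unit /= oner_neq0 mulf_neq0.
by rewrite PE unitmx_mul => /andP[_ uP]; apply/mxsimilarP; exists P.
Qed.

(** Repeated use of [lsim2] pushes the whole discriminant into the last entry. *)
Lemma lsim_canon x (s : seq F) : all (predC1 0) (x :: s) ->
  lsim (x :: s) (rcons (nseq (size s) 1) (x * \prod_(y <- s) y)).
Proof.
elim: s x => [|y s IHs] x.
  by rewrite big_nil mulr1 => _; apply: lsim_refl.
case/and3P=> /= x0 y0 s0; rewrite big_cons mulrA.
apply: (@lsim_trans _ ([:: 1; x * y] ++ s)).
  by apply: (@lsim_cat _ [:: x; y]); [apply: lsim2 | apply: lsim_refl].
apply: (@lsim_cat _ [:: 1] _ [:: 1]); first exact: lsim_refl.
by apply: IHs; apply/andP; split; [apply: mulf_neq0 | apply: s0].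
Qed.

Lemma lsim1 (a b : F) : b * a \in nzsq F -> lsim [:: a] [:: b].
Proof.
move=> sab; have a0 := nzsqM_neq0 sab.
have [x x0 def_b] : exists2 x, x != 0 & b = a * x ^+ 2.
  case/nzsqP: sab => x x0 e; exists (x / a).
    by rewrite mulf_neq0 ?invr_eq0.
  by rewrite exprMn -e; field.
apply/mxsimilarP; exists x%:M; first by rewrite unitmxE det_scalar1 unitfE.
apply/matrixP=> i j; rewrite tr_scalar_mx mul_scalar_mx mul_mx_scalar.
by rewrite !mxE !ord1 /= def_b ?mulr1n expr2; ring.
Qed.

Lemma lsim_nzsq (s t : seq F) : all (predC1 0) s -> all (predC1 0) t ->
  size s = size t -> \prod_(x <- s) x * \prod_(x <- t) x \in nzsq F -> lsim s t.
Proof.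
case: s t => [|x s] [|y t] // s0 t0 => [_ _|/eqP]; first exact: lsim_refl.
rewrite eqSS => /eqP e sst; have {}e : size s = size t := e.
apply: lsim_trans (lsim_canon s0) _.
apply: lsim_trans (lsim_sym (lsim_canon t0)).
rewrite -e -!cats1; apply: lsim_cat; first exact: lsim_refl.
by apply: lsim1; rewrite mulrC; move: sst; rewrite !big_cons.
Qed.

(* [has_disc A r d]: the form A has rank r and its nondegenerate part has
   discriminant d modulo nonzero squares. *)
Definition has_disc n (A : 'M[F]_n) (r : nat) (d : F) :=
  exists s, [/\ size s = r, all (predC1 0) s, \prod_(x <- s) x * d \in nzsq F &
                mxsimilar A (dgmx (s ++ nseq (n - r) 0))].

Lemma has_disc_leq n (A : 'M[F]_n) r d : has_disc A r d -> (r <= n)%N.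
Proof.
by case=> s [<- _ _ [e _]]; rewrite [leqRHS]e size_cat leq_addr.
Qed.

(** Size, rank and square class of the discriminant determine the form: [lsim_nzsq] compares the
    nondegenerate parts, and the zero paddings agree. *)
Lemma mxsimilar_of_disc n m (A : 'M[F]_n) (B : 'M[F]_m) r d e : n = m ->
  d * e \in nzsq F -> has_disc A r d -> has_disc B r e -> mxsimilar A B.
Proof.
move=> enm; case: m / enm B => B de [s [szs s0 sd As]] [t [szt t0 te Bt]].
apply: mxsimilar_trans As _; apply: mxsimilar_trans (mxsimilar_sym Bt).
apply: lsim_cat (lsim_refl _); apply: lsim_nzsq; rewrite ?szs ?szt //.
rewrite -(nzsqMl _ (nzsq_sqr (nzsq_neq0 de))).
have -> : forall u v, (d * e) ^+ 2 * (u * v) = d * e * (u * d * (v * e)).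
  by move=> u v; ring.
by rewrite nzsqM // nzsqM.
Qed.

Lemma has_disc_mxsimilar n m (A : 'M[F]_n) (B : 'M[F]_m) r d :
  mxsimilar A B -> has_disc A r d -> has_disc B r d.
Proof.
move=> AB [s [szs s0 sd As]]; exists s; split=> //.
have nm : n = m by case: AB.
by have := mxsimilar_trans (mxsimilar_sym AB) As; rewrite nm.
Qed.

Lemma has_disc_mulsq n (A : 'M[F]_n) r (d e : F) :
  d * e \in nzsq F -> has_disc A r d -> has_disc A r e.
Proof.
move=> de [s [szs s0 sd As]]; exists s; split=> //.
have d0 : d ^+ 2 \in nzsq F.
  by rewrite nzsq_sqr //; apply: (@nzsqM_neq0 _ e); rewrite mulrC.
rewrite -(nzsqMl _ d0).
have -> (p : F) : d ^+ 2 * (p * e) = p * d * (d * e) by ring.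
exact: nzsqM.
Qed.

Lemma has_disc_unit n (A : 'M[F]_n) :
  A^T = A -> A \in unitmx -> has_disc A n (\det A).
Proof.
move=> sA uA; have [s [szs s0 As [x x0 def_s]]] :=
  sym_unitmx_diagonalizable two0 sA uA.
exists s; split=> //; last by rewrite subnn cats0.
rewrite def_s mulrAC -expr2 -exprMn nzsq_sqr // mulf_neq0 //.
by rewrite -unitfE -unitmxE.
Qed.

Lemma has_disc0 n : has_disc (0 : 'M[F]_n) 0 1.
Proof.
exists [::]; split=> //; first by rewrite big_nil mulr1 nzsq1.
by rewrite subn0; apply: mxsimilar_dgmx0.
Qed.

Lemma has_disc_block n m (A : 'M[F]_n) (B : 'M[F]_m) r d q e :
  has_disc A r d -> has_disc B q e ->
  has_disc (block_mx A 0 0 B) (r + q) (d * e).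
Proof.
move=> hA hB; have rn := has_disc_leq hA; have qm := has_disc_leq hB.
case: hA hB => s [szs s0 sd As] [t [szt t0 te Bt]].
exists (s ++ t); rewrite size_cat szs szt all_cat s0 t0; split=> //.
  by rewrite big_cat /= mulrACA nzsqM.
apply: mxsimilar_trans (mxsimilar_block As Bt) _.
apply: mxsimilar_trans (mxsimilar_sym (dgmx_cat _ _)) _.
(* With truncated subtraction, this splitting relies on [r <= n] and [q <= m]. *)
have -> : (n + m - (r + q) = (n - r) + (m - q))%N.
  by rewrite subnDA -addnBAC // addnBA.
rewrite nseqD; apply: lsim_perm; rewrite -!catA perm_cat2l perm_catCA //.
Qed.

Lemma has_disc_mxdiag m (p_ : 'I_m -> nat) (A : forall i, 'M[F]_(p_ i)) r d :
  (forall i, has_disc (A i) (r i) (d i)) ->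
  has_disc (\mxdiag_i A i) (\sum_i r i) (\prod_i d i).
Proof.
elim: m p_ A r d => [|m IHm] p_ A r d hA.
  rewrite [X in has_disc _ X]big_ord0 [X in has_disc _ _ X]big_ord0.
  rewrite (_ : \mxdiag_i A i = 0); first exact: has_disc0.
  by apply/matrixP=> i; have := ltn_ord i; rewrite {2}big_ord0.
rewrite [X in has_disc _ X]big_ord_recl [X in has_disc _ _ X]big_ord_recl.
rewrite mxdiag_recl.
apply: has_disc_mxsimilar (mxsimilar_cast _ _ _) _.
by apply: has_disc_block (hA _) (IHm _ _ _ _ _) => i.
Qed.

Lemma has_disc_mxcopies n k (A : 'M[F]_n) r d :
  has_disc A r d -> has_disc (mxcopies k A) (k * r) (d ^+ k).
Proof.
move=> hA.
have := @has_disc_mxdiag k (fun=> n) (fun=> A) (fun=> r) (fun=> d) (fun=> hA).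
by rewrite [X in has_disc _ X]sum_nat_const prodr_const card_ord.
Qed.

End Classification.

(** * Graphs *)

Section Graphs.
Variable F : finFieldType.
Hypothesis two0 : 2%:R != 0 :> F.

Lemma adjmx_tr (X : sgraph) : (adjmx F X)^T = adjmx F X.
Proof. by apply/matrixP=> i j; rewrite !mxE adj_sym. Qed.

(** Adjacency pulled back along [f] stays symmetric and irreflexive, so the nonsingular principal
    submatrix is again the matrix of a graph, and its determinant is the discriminant. *)
Lemma adjmx_disc (X : sgraph) : exists r (e : rel 'I_r),
  [/\ symmetric e, irreflexive e,
      \det (\matrix_(i, j) (e i j)%:R : 'M[F]_r) != 0 &
      has_disc (adjmx F X) r (\det (\matrix_(i, j) (e i j)%:R : 'M[F]_r))].
Proof.
have [r [f [uM XM]]] := sym_principal_submx (adjmx_tr X).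
pose e : rel 'I_r := fun i j => adj (enum_val (f i)) (enum_val (f j)).
have e_sym : symmetric e by move=> i j; apply: adj_sym.
have e_irr : irreflexive e by move=> i; apply: adj_irr.
have defM : mxsub f f (adjmx F X) = \matrix_(i, j) (e i j)%:R.
  by apply/matrixP=> i j; rewrite !mxE.
rewrite defM in uM XM; exists r, e; split=> //.
  by rewrite -unitfE -unitmxE.
apply: has_disc_mxsimilar (mxsimilar_sym XM) _.
rewrite -[X in has_disc _ X]addn0 -[X in has_disc _ _ X]mulr1.
apply: has_disc_block (has_disc0 _ _) => //; apply: has_disc_unit => //.
by apply/matrixP=> i j; rewrite !mxE e_sym.
Qed.

(** The relation [e'] mirrors [e] on plain numbers, so that [laplace] can evaluate the discriminant
    of a concrete graph. *)
Lemma has_disc_adjmx n (e : rel 'I_n) e_sym e_irr (e' : rel nat) (z : int) :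
  (forall i j : 'I_n, e i j = e' i j) ->
  int_of_Z (laplace n (relmx e' (iota 0 n))) = z -> z%:~R != 0 :> F ->
  has_disc (adjmx F (@SGraph _ e e_sym e_irr)) n z%:~R.
Proof.
move=> ee' def_z d0; pose A : 'M[F]_n := \matrix_(i, j) (e i j)%:R.
have detA : \det A = z%:~R.
  rewrite -def_z -(det_relmx F 0%N) ?size_iota //; congr (\det _).
  by apply/matrixP=> i j; rewrite !mxE ee' !nth_iota.
have XA : mxsimilar A (adjmx F (@SGraph _ e e_sym e_irr)).
  have -> : A =
      castmx (card_ord n, card_ord n) (adjmx F (@SGraph _ e e_sym e_irr)).
    apply/matrixP=> i j; rewrite castmxE !mxE /= !enum_val_ord.
    by congr ((e _ _)%:R); apply: val_inj.
  exact: mxsimilar_sym (mxsimilar_cast _ _ _).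
apply: has_disc_mxsimilar XA _; rewrite -detA; apply: has_disc_unit => //.
  by apply/matrixP=> i j; rewrite !mxE e_sym.
by rewrite unitmxE detA unitfE.
Qed.

(** Reduces a decomposition to arithmetic: sizes and ranks add up, discriminants multiply modulo
    squares. *)
Lemma decomposes_disc (X : sgraph) (Xs : seq sgraph) (n rk : seq nat)
    (dc : seq F) r d :
  has_disc (adjmx F X) r d ->
  (forall i, (i < size Xs)%N ->
    has_disc (adjmx F (nth (K 0) Xs i)) (nth 0%N rk i) dc`_i) ->
  #|X| = (\sum_(i < size Xs) nth 0%N n i * #|nth (K 0) Xs i|)%N ->
  r = (\sum_(i < size Xs) nth 0%N n i * nth 0%N rk i)%N ->
  d * (\prod_(i < size Xs) dc`_i ^+ nth 0%N n i) \in nzsq F ->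
  decomposes F X Xs.
Proof.
move=> hX hXs cardX def_r def_d; exists (fun i => nth 0%N n i).
apply: mxsimilar_of_disc def_d hX _.
  by rewrite cardX; apply: eq_bigr => i _; rewrite sum_nat_const card_ord.
rewrite def_r; apply: has_disc_mxdiag => i; apply: has_disc_mxcopies.
exact: hXs (ltn_ord i).
Qed.

(** * Graphs when -1 and 3 are squares and 2 is not *)

Section Primes.
Hypothesis sq_m1 : -1 \in nzsq F.
Hypothesis sq_3 : 3%:R \in nzsq F.
Hypothesis nsq_2 : 2%:R \notin nzsq F.

Lemma nzsqN a : (- a \in nzsq F) = (a \in nzsq F).
Proof. by rewrite -mulN1r nzsqMl. Qed.

Lemma nzsq4 : 4%:R \in nzsq F.
Proof. by rewrite (natrM _ 2 2) -expr2 nzsq_sqr. Qed.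

Lemma has_disc_K1 : has_disc (adjmx F (K 1)) 0 1.
Proof.
rewrite (_ : adjmx _ _ = 0); first exact: has_disc0.
apply/matrixP=> i j; rewrite !mxE /= /complete_adj /=.
by rewrite (ord1 (enum_val i)) (ord1 (enum_val j)) eqxx.
Qed.

Lemma has_disc_K2 : has_disc (adjmx F (K 2)) 2 1.
Proof.
apply: (has_disc_mulsq (d := (-1)%:~R)); first by rewrite mulr1.
apply: (has_disc_adjmx _ _ (e' := [rel u v : nat | u != v])) => //.
exact: nzsq_neq0.
Qed.

Lemma has_disc_K3 : has_disc (adjmx F (K 3)) 3 2%:R.
Proof.
by apply: (has_disc_adjmx _ _ (e' := [rel u v : nat | u != v]) (z := 2)).
Qed.

Definition edges_rel (E : seq (nat * nat)) : rel nat :=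
  [rel u v | (u != v) && (((u, v) \in E) || ((v, u) \in E))].

(** The determinant is -4, a square because -1 is one. *)
Lemma has_disc_B : has_disc (adjmx F B) 5 1.
Proof.
apply: (has_disc_mulsq (d := (-4)%:~R)).
  by rewrite mulr1 rmorphN nzsqN nzsq4.
apply: (has_disc_adjmx _ _ (e' := edges_rel
  [:: (0, 1); (0, 2); (0, 3); (0, 4); (1, 2); (3, 4)]%N)) => //.
by rewrite rmorphN oppr_eq0 nzsq_neq0 ?nzsq4.
Qed.

(** The determinant is -5, in the square class of 2: -1 is a square, and 5 and 2 are nonsquares. *)
Lemma has_disc_K6 : 5%:R != 0 :> F -> 5%:R \notin nzsq F ->
  has_disc (adjmx F (K 6)) 6 2%:R.
Proof.
move=> five0 nsq_5; apply: (has_disc_mulsq (d := (-5)%:~R)).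
  by rewrite rmorphN mulNr nzsqN nonsquareM.
apply: (has_disc_adjmx _ _ (e' := [rel u v : nat | u != v])) => //.
by rewrite rmorphN oppr_eq0.
Qed.

(** The determinant is 7, in the square class of 2 since both are nonsquares. *)
Lemma has_disc_D : 7%:R != 0 :> F -> 7%:R \notin nzsq F ->
  has_disc (adjmx F D) 6 2%:R.
Proof.
move=> seven0 nsq_7.
apply: (has_disc_mulsq (d := 7%:~R)); first by rewrite nonsquareM.
by apply: (has_disc_adjmx _ _ (e' := edges_rel
  [:: (0, 1); (1, 2); (2, 3); (3, 0); (1, 3);
      (4, 0); (4, 1); (4, 3); (5, 1); (5, 2); (5, 3)]%N)) => //.
Qed.

(** Exhaustive evaluation over the 2^15 labelled graphs on six vertices. *)
Lemma graph_dets6 :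
  all (fun A => int_of_Z (laplace 6 A) \in [:: 0; -1; 3; 4; -4; -5; 7])
  (graph_matrices 6).
Proof. by vm_compute. Qed.

Lemma graph_rank_disc (X : sgraph) : exists r d,
  [/\ has_disc (adjmx F X) r d, d != 0,
      d \in nzsq F -> (r != 1)%N && (r != 3)%N,
      d \notin nzsq F -> odd r && (r != 1)%N || (6 <= r)%N &
      d \notin nzsq F -> r = 6 ->
        5%:R != 0 :> F /\ 5%:R \notin nzsq F \/
        7%:R != 0 :> F /\ 7%:R \notin nzsq F].
Proof.
have [r [e [e_sym e_irr d0 Xrd]]] := adjmx_disc X.
exists r, (\det (\matrix_(i, j) (e i j)%:R)); split=> //.
(* Nonzero determinants do not occur on 1 vertex, and on 3 vertices only the nonsquare 2 does. *)
- case: r e e_sym e_irr d0 {Xrd} => [|[|[|[|r]]]] e e_sym e_irr //.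
    have := @det_graph F 1 [:: 0] e isT e_sym e_irr.
    by rewrite inE => ->.
  have := @det_graph F 3 [:: 0; 2] e isT e_sym e_irr.
  by rewrite !inE => /orP[->|/eqP->] // _; rewrite (negbTE nsq_2).
(* The ranks to exclude are 0, 1, 2 and 4, where every nonzero determinant is a square. *)
- case: r e e_sym e_irr d0 {Xrd} => [|[|[|[|[|[|r]]]]]] e e_sym e_irr;
    rewrite ?orbT //.
  + by rewrite det_mx00 nzsq1.
  + have := @det_graph F 1 [:: 0] e isT e_sym e_irr.
    by rewrite inE => ->.
  + have := @det_graph F 2 [:: 0; -1] e isT e_sym e_irr.
    by rewrite !inE => /orP[->|/eqP->] // _; rewrite sq_m1.
  have := @det_graph F 4 [:: 0; 1; -3] e isT e_sym e_irr.
  rewrite !inE => /or3P[->|/eqP->|/eqP->] // _; first by rewrite nzsq1.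
  by rewrite rmorphN nzsqN sq_3.
(* Among the nonzero determinants of order 6, only -5 and 7 can be nonsquares. *)
move=> {Xrd} nsd /esym r6; case: r / r6 e e_sym e_irr d0 nsd => e e_sym e_irr.
have := det_graph F graph_dets6 e_sym e_irr.
rewrite !inE => /or4P[->|/eqP->|/eqP->|/or4P[/eqP->|/eqP->|/eqP->|/eqP->]] //.
- by rewrite sq_m1.
- by rewrite sq_3.
- by rewrite nzsq4.
- by rewrite rmorphN nzsqN nzsq4.
- by rewrite rmorphN nzsqN oppr_eq0; left.
by right.
Qed.

(** The building blocks have ranks 0, 2, 3, 5 and 6; only the third and fifth have discriminant 2,
    hence the exponent [n3 + n5]. Copies of [K 1] fill up the size. *)
Lemma multiplicities N r (d : F) : (r <= N)%N -> d != 0 ->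
  (d \in nzsq F -> (r != 1)%N && (r != 3)%N) ->
  (d \notin nzsq F -> odd r && (r != 1)%N || (6 <= r)%N) ->
  exists n1 n2 n3 n4 n5 : nat,
    [/\ N = (n1 + n2 * 2 + n3 * 3 + n4 * 5 + n5 * 6)%N,
        r = (n2 * 2 + n3 * 3 + n4 * 5 + n5 * 6)%N,
        d * 2%:R ^+ (n3 + n5) \in nzsq F &
        n5 = 0%N \/ r = 6 /\ d \notin nzsq F].
Proof.
move=> leN d0.
case: (boolP (d \in nzsq F)) => [sd /(_ isT) hr _|nsd _ /(_ isT) hr].
  have [odd_r|even_r] := boolP (odd r).
    (* An odd [r] other than 1 and 3 is at least 5: one [B], then copies of [K 2]. *)
    exists (N - r)%N, ((r - 5)./2)%N, 0%N, 1%N, 0%N.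
    by rewrite mulr1; split; [lia | lia | | left].
  exists (N - r)%N, (r./2)%N, 0%N, 0%N, 0%N.
  by rewrite mulr1; split; [lia | lia | | left].
have sd2 : d * 2%:R ^+ 1 \in nzsq F by rewrite nonsquareM.
have [odd_r|even_r] := boolP (odd r).
  (* One [K 3] corrects both the parity and the square class. *)
  exists (N - r)%N, ((r - 3)./2)%N, 1%N, 0%N, 0%N.
  by split; [lia | lia | | left].
have [r6|r6] := eqVneq r 6.
  exists (N - r)%N, 0%N, 0%N, 0%N, 1%N.
  by split; [lia | lia | | right].
(* The rank is now even and at least 8: [K 3] and [B] together have rank 8 and nonsquare
   discriminant. *)
exists (N - r)%N, ((r - 8)./2)%N, 1%N, 1%N, 0%N.
by split; [lia | lia | | left].
Qed.

Lemma has_disc_basic i : (i < 4)%N ->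
  has_disc (adjmx F (nth (K 0) [:: K 1; K 2; K 3; B] i))
    (nth 0 [:: 0; 2; 3; 5] i)%N [:: 1; 1; 2%:R; 1]`_i.
Proof.
case: i => [|[|[|[|//]]]] _ /=.
- exact: has_disc_K1.
- exact: has_disc_K2.
- exact: has_disc_K3.
exact: has_disc_B.
Qed.

(** Only size, rank and discriminant of [Y] matter, so this serves both [K 6] and [D]. *)
Lemma decomposes_basic_rank6 (X Y : sgraph) :
  #|Y| = 6 -> has_disc (adjmx F Y) 6 2%:R ->
  decomposes F X [:: K 1; K 2; K 3; B; Y].
Proof.
move=> cardY disc_Y; have [r [d [Xrd d0 h1 h2 _]]] := graph_rank_disc X.
have [n1 [n2 [n3 [n4 [n5 [defN def_r def_d _]]]]]] :=
  multiplicities (has_disc_leq Xrd) d0 h1 h2.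
apply: (@decomposes_disc X _ [:: n1; n2; n3; n4; n5] [:: 0; 2; 3; 5; 6]%N
  [:: 1; 1; 2%:R; 1; 2%:R] _ _ Xrd).
- case=> [|[|[|[|[|//]]]]] _ //=.
  + exact: (@has_disc_basic 0).
  + exact: (@has_disc_basic 1).
  + exact: (@has_disc_basic 2).
  + exact: (@has_disc_basic 3).
- by rewrite defN !big_ord_recl big_ord0 /= !card_ord cardY; lia.
- by rewrite def_r !big_ord_recl big_ord0 /=; lia.
by rewrite !big_ord_recl big_ord0 /= !expr1n !mul1r mulr1 -exprD.
Qed.

Lemma decomposes_basic (X : sgraph) :
  (5%:R = 0 :> F) \/ 5%:R \in nzsq F -> (7%:R = 0 :> F) \/ 7%:R \in nzsq F ->
  decomposes F X [:: K 1; K 2; K 3; B].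
Proof.
move=> h5 h7; have [r [d [Xrd d0 h1 h2 h6]]] := graph_rank_disc X.
have [n1 [n2 [n3 [n4 [n5 [defN def_r def_d n50]]]]]] :=
  multiplicities (has_disc_leq Xrd) d0 h1 h2.
(* A sixth-rank form of nonsquare discriminant would make 5 or 7 a nonzero nonsquare. *)
have {h5 h7 h6} {}n50 : n5 = 0%N.
  case: n50 => // -[r6 nsd]; have := h6 nsd r6.
  by case=> -[/eqP ? /negP ?]; [case: h5 | case: h7].
move: defN def_r def_d; rewrite n50 => defN def_r def_d.
apply: (@decomposes_disc X _ [:: n1; n2; n3; n4] [:: 0; 2; 3; 5]%N
  [:: 1; 1; 2%:R; 1] _ _ Xrd).
- exact: has_disc_basic.
- by rewrite defN !big_ord_recl big_ord0 /= !card_ord; lia.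
- by rewrite def_r !big_ord_recl big_ord0 /=; lia.
by rewrite !big_ord_recl big_ord0 /= !expr1n !mul1r !mulr1 -[n3]addn0.
Qed.

End Primes.
End Graphs.

Theorem theorem3 (p : nat) (p_prime : prime p) (p_ge5 : (5 <= p)%N)
    (sq_m1 : -1 \in Fsquares p) (sq_3 : 3%:R \in Fsquares p)
    (nsq_2 : 2%:R \in Fnonsquares p) :
  [/\ 5%:R \in Fnonsquares p ->
        forall X : sgraph, decomposes 'F_p X [:: K 1; K 2; K 3; B; K 6],
      7%:R \in Fnonsquares p ->
        forall X : sgraph, decomposes 'F_p X [:: K 1; K 2; K 3; B; D]
    & 5%:R \notin Fnonsquares p -> 7%:R \notin Fnonsquares p ->
        forall X : sgraph, decomposes 'F_p X [:: K 1; K 2; K 3; B]].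
Proof.
(* [Fsquares p] and [nzsq 'F_p] unfold to the same set. *)
have nonsqE (a : 'F_p) :
    (a \in Fnonsquares p) = (a \notin nzsq 'F_p) && (a != 0).
  by rewrite !inE.
move: nsq_2; rewrite !nonsqE => /andP[nsq2 two0].
split=> [/andP[nsq5 five0] X|/andP[nsq7 seven0] X|h5 h7 X].
- by apply: decomposes_basic_rank6 => //;
    [rewrite card_ord | apply: has_disc_K6].
- by apply: decomposes_basic_rank6 => //;
    [rewrite card_ord | apply: has_disc_D].
have sqP (a : 'F_p) :
    ~~ ((a \notin nzsq 'F_p) && (a != 0)) -> a = 0 \/ a \in nzsq 'F_p.
  by rewrite negb_and !negbK => /orP[|/eqP]; [right | left].
by apply: decomposes_basic => //; apply: sqP.
Qed.
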